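(* Let $\mathcal{A}=\{A,B,R\}$ be three quantum systems with finite-dimensional Hilbert spaces and let $\rho_{ABR}$ be a state. For $q>1$ let $\mathfrak{X}_q^{\Delta_{\{A,B\}}}(\infty)$ be the integrated Euler characteristic of the persistence complex defined by the $q$-deformed total correlation $C_q$, computed in homology relative to the subcomplex $\Delta_{\{A,B\}}$. Then $$\lim_{q\to1}\mathfrak{X}_q^{\Delta_{\{A,B\}}}(\infty)=-I(A:B|R)_\rho\le0,$$ where $I(A:B|R)_\rho=S(AR)+S(BR)-S(R)-S(ABR)$ is the quantum conditional mutual information (von Neumann entropies of the corresponding marginals of $\rho$).
   Context: Tsallis entropy $S_q(J)_\rho=\frac{1}{1-q}(\operatorname{Tr}\rho_J^q-1)$ for nonempty $J\subseteq\mathcal{A}$ with reduced state $\rho_J$; $S(J)=-\operatorname{Tr}\rho_J\log\rho_J$. The $q$-deformed total correlation is $C_q(J)_\rho=\sum_{v\in J}S_q(\{v\})_\rho-S_q(J)_\rho$. The filtration is $G(\varepsilon)=\{\varnothing\ne J\subseteq\mathcal{A}:C_q(J)_\rho\le\varepsilon\}$, $\varepsilon\in\mathbb{R}$. $\Delta_{\{A,B\}}$ denotes the simplicial complex of nonempty subsets of $\{A,B\}$. The relative Betti numbers are $\beta_k^{\mathrm{rel}}(\varepsilon)=\operatorname{rank}H_k(G(\varepsilon),G(\varepsilon)\cap\Delta_{\{A,B\}};\mathbb{Z}_2)$ (simplicial homology relative to the subcomplex), and $\mathfrak{X}_q^{\Delta_{\{A,B\}}}(\infty)=\sum_{k\ge0}(-1)^k\int_0^\infty\beta_k^{\mathrm{rel}}(\varepsilon)d\varepsilon$.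 *)

(* Defs.v *)
From HB Require Import structures.
From mathcomp Require Import all_boot all_order all_algebra.
From mathcomp Require Import sesquilinear spectral.
From mathcomp Require Import complex mxtens.
From mathcomp Require Import all_classical all_reals all_analysis.

Set Implicit Arguments.
Unset Strict Implicit.
Unset Printing Implicit Defensive.

Import Order.TTheory GRing.Theory Num.Theory.
Import numFieldNormedType.Exports.
Local Open Scope ring_scope.

(* The Hilbert space of the tripartite system ABR is C^(dA*dB*dR),     *)
(* with basis index (a,b,r) |-> mxtens_index (mxtens_index (a,b), r). *)

Section Quantum.
Variable R : realType.
Local Notation C := (R[i]).

(* positive semidefinite: <v, M v> >= 0 for all v (in C the order     *)
(* 0 <= z means z is a nonnegative real)                               *)
Definition psd n (M : 'M[C]_n) : Prop :=
  forall v : 'I_n -> C, 0 <= \sum_(i < n) \sum_(j < n) (v i)^* * M i j * v j.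

Definition density n (M : 'M[C]_n) : Prop := psd M /\ \tr M = 1.

(* Eigenvalues (with multiplicity) of a normal matrix via the spectral *)
(* theorem M = U^-1 diag(lambda) U; for a Hermitian matrix they are    *)
(* real, so we take real parts.                                        *)
Definition eigs n (M : 'M[C]_n) (i : 'I_n) : R := complex.Re (spectral_diag M 0 i).

Definition trpow (q : R) n (M : 'M[C]_n) : R := \sum_(i < n) (eigs M i) `^ q.
Definition tsallis (q : R) n (M : 'M[C]_n) : R := (trpow q M - 1) / (1 - q).
Definition vonNeumann n (M : 'M[C]_n) : R := - \sum_(i < n) eigs M i * ln (eigs M i).

Variables dA dB dR : nat.
Local Notation N := (dA * dB * dR)%N.

Definition ix (a : 'I_dA) (b : 'I_dB) (r : 'I_dR) : 'I_N :=
  mxtens_index (mxtens_index (a, b), r).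

Definition rhoAB (rho : 'M[C]_N) : 'M[C]_(dA * dB) :=
  \matrix_(i, j) \sum_(r < dR)
     rho (ix (mxtens_unindex i).1 (mxtens_unindex i).2 r)
         (ix (mxtens_unindex j).1 (mxtens_unindex j).2 r).
Definition rhoAR (rho : 'M[C]_N) : 'M[C]_(dA * dR) :=
  \matrix_(i, j) \sum_(b < dB)
     rho (ix (mxtens_unindex i).1 b (mxtens_unindex i).2)
         (ix (mxtens_unindex j).1 b (mxtens_unindex j).2).
Definition rhoBR (rho : 'M[C]_N) : 'M[C]_(dB * dR) :=
  \matrix_(i, j) \sum_(a < dA)
     rho (ix a (mxtens_unindex i).1 (mxtens_unindex i).2)
         (ix a (mxtens_unindex j).1 (mxtens_unindex j).2).
Definition rhoA (rho : 'M[C]_N) : 'M[C]_dA :=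
  \matrix_(i, j) \sum_(b < dB) \sum_(r < dR) rho (ix i b r) (ix j b r).
Definition rhoB (rho : 'M[C]_N) : 'M[C]_dB :=
  \matrix_(i, j) \sum_(a < dA) \sum_(r < dR) rho (ix a i r) (ix a j r).
Definition rhoR (rho : 'M[C]_N) : 'M[C]_dR :=
  \matrix_(i, j) \sum_(a < dA) \sum_(b < dB) rho (ix a b i) (ix a b j).

Definition vA : 'I_3 := @Ordinal 3 0 isT.
Definition vB : 'I_3 := @Ordinal 3 1 isT.
Definition vR : 'I_3 := @Ordinal 3 2 isT.

Definition marg (h : forall n, 'M[C]_n -> R) (rho : 'M[C]_N) (J : {set 'I_3}) : R :=
  match vA \in J, vB \in J, vR \in J with
  | true, true, true => h _ rho
  | true, true, false => h _ (rhoAB rho)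
  | true, false, true => h _ (rhoAR rho)
  | false, true, true => h _ (rhoBR rho)
  | true, false, false => h _ (rhoA rho)
  | false, true, false => h _ (rhoB rho)
  | false, false, true => h _ (rhoR rho)
  | false, false, false => 0 (* empty J: never used *)
  end.

Definition Sq (q : R) rho J := marg (tsallis q) rho J.
Definition S rho J := marg vonNeumann rho J.

Definition Cq (q : R) rho (J : {set 'I_3}) : R :=
  \sum_(v in J) Sq q rho [set v] - Sq q rho J.

Definition CMI rho : R :=
  S rho [set vA; vR] + S rho [set vB; vR] - S rho [set vR] - S rho [set vA; vB; vR].

Definition Gfilt (q : R) rho (eps : R) : {set {set 'I_3}} :=
  [set J : {set 'I_3} | (J != finset.set0) && (Cq q rho J <= eps)].

End Quantum.

(* Relative simplicial homology H_k(G, G ∩ Δ_{A,B}; Z_2).              *)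
(* Relative k-chains C_k(G)/C_k(G∩Δ) are identified with the span of   *)
(* the k-simplices of G not in Δ_{A,B}; the relative boundary is the   *)
(* Z_2-boundary followed by the projection killing simplices of Δ.     *)
(* Chains live in F_2^{#subsets of 'I_3} (row vectors, matrices act on *)
(* the right).                                                         *)

Notation NS := #|{: {set 'I_3}}|.
Definition sx (i : 'I_NS) : {set 'I_3} := enum_val i.

Definition DeltaAB : {set {set 'I_3}} :=
  [set J : {set 'I_3} | (J != finset.set0) && (J \subset [set vA; vB])].

Definition relsimp (G : {set {set 'I_3}}) (k : nat) : {set {set 'I_3}} :=
  [set J in G | (J \notin DeltaAB) && (#|J| == k.+1)].

(* projector whose row space is the relative chain space C_k *)
Definition chains (G : {set {set 'I_3}}) (k : nat) : 'M['F_2]_NS :=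
  \matrix_(i, j) ((i == j) && (sx i \in relsimp G k))%:R.

Definition bdry (G : {set {set 'I_3}}) (k : nat) : 'M['F_2]_NS :=
  if k is k'.+1 then
    \matrix_(i, j) [&& sx i \in relsimp G k, sx j \in relsimp G k'
                     & sx j \subset sx i]%:R
  else 0.

Definition cycles G k : 'M['F_2]_NS := (chains G k :&: kermx (bdry G k))%MS.
Definition boundaries G k : 'M['F_2]_NS := (chains G k.+1 *m bdry G k.+1)%MS.

Definition betti_rel (G : {set {set 'I_3}}) (k : nat) : nat :=
  (\rank (cycles G k) - \rank (boundaries G k))%N.

(* (simplices on 3 vertices have dimension <= 2, so k ranges over < 3) *)
Definition Xq (R : realType) (dA dB dR : nat) (q : R)
    (rho : 'M[R[i]]_(dA * dB * dR)) : R :=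
  \sum_(k < 3) (-1) ^+ k *
    Rintegral lebesgue_measure `[0%R, +oo[%classic
      (fun eps : R => ((betti_rel (Gfilt q rho eps) k)%:R : R)).

(* Main.v *)
Require Import Defs.
From mathcomp Require Import all_boot all_order all_algebra.
From mathcomp Require Import sesquilinear spectral complex mxtens.
From mathcomp Require Import all_classical all_reals all_analysis.
From mathcomp Require Import ring lra.

(** For [eps >= 0] the relative simplices are among R, AR, BR and ABR, so the
    integrated Euler characteristic is an explicit continuous function of the
    three numbers [C_q(AR)], [C_q(BR)], [C_q(ABR)]. Tsallis entropies converge to
    von Neumann entropies as [q] tends to 1, and at [q = 1] subadditivity puts
    these numbers in the region where that function is [x + y - z], which is
    [- I(A:B|R)].

    The sign is strong subadditivity. Write [p_k], [s_l] for the eigenvalues of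
    [rho], [sigma] and [g_kl] for the overlaps of their eigenvectors. Then
    [Q_t = sum_kl |g_kl|^2 p_k^2 / (t p_k + s_l)] is the maximum over [X] of
    [2 Re tr(rho X) - t tr(rho X X^* ) - tr(sigma X^* X)]; inserting
    [X (x) 1] shows that [Q_t] does not increase under partial traces.
    Integrating over [t] gives the monotonicity of the relative entropy, and
    the pair [rho_ABR], [1_A (x) rho_BR] with B traced out gives strong
    subadditivity. *)

Set Implicit Arguments.
Unset Strict Implicit.
Unset Printing Implicit Defensive.
Import Order.TTheory GRing.Theory Num.Theory.
Import numFieldNormedType.Exports.
Local Open Scope ring_scope.

(** * Sums over product types and against Kronecker deltas *)

Lemma sum_pair (V : nmodType) (I J : finType) (F : I * J -> V) :
  \sum_p F p = \sum_i \sum_j F (i, j).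
Proof. by rewrite pair_bigA; apply: eq_bigr => -[]. Qed.

Lemma sum_delta (V : pzSemiRingType) (I : finType) (i : I) (F : I -> V) :
  \sum_j (i == j)%:R * F j = F i.
Proof.
rewrite (bigD1 i) //= eqxx mul1r big1 ?addr0 // => j /negPf ji.
by rewrite eq_sym ji mul0r.
Qed.

(** * Kernels on finite types *)

(* Arbitrary finite index types allow tensor factors to be regrouped without
   casting matrix dimensions. *)
Section Kernels.
Variable C : numClosedFieldType.
Implicit Types I J K L : finType.

Definition kmul I J K (F : I -> J -> C) (G : J -> K -> C) : I -> K -> C :=
  fun x z => \sum_y F x y * G y z.
Definition kadj I J (F : I -> J -> C) : J -> I -> C := fun x y => (F y x)^*.
Definition kone I : I -> I -> C := fun x y => (x == y)%:R.
Definition kdiag I (p : I -> C) : I -> I -> C := fun x y => (x == y)%:R * p y.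
Definition ktr I (F : I -> I -> C) : C := \sum_x F x x.

Local Infix "**" := kmul (at level 40, left associativity).

Lemma kmulA I J K L (F : I -> J -> C) (G : J -> K -> C) (H : K -> L -> C) :
  F ** (G ** H) = F ** G ** H.
Proof.
apply/funext => x; apply/funext => w; rewrite /kmul.
under eq_bigr do rewrite mulr_sumr.
rewrite exchange_big /=; apply: eq_bigr => z _; rewrite mulr_suml.
by apply: eq_bigr => y _; rewrite mulrA.
Qed.

Lemma kmul1k I J (F : I -> J -> C) : @kone I ** F = F.
Proof. by apply/funext => x; apply/funext => y; rewrite /kmul sum_delta. Qed.

Lemma kmulk1 I J (F : I -> J -> C) : F ** @kone J = F.
Proof.
apply/funext => x; apply/funext => y; rewrite /kmul.
by under eq_bigr => z _ do rewrite /kone eq_sym mulrC; rewrite sum_delta.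
Qed.

Lemma kadjM I J K (F : I -> J -> C) (G : J -> K -> C) :
  kadj (F ** G) = kadj G ** kadj F.
Proof.
apply/funext => x; apply/funext => y; rewrite /kadj /kmul rmorph_sum.
by apply: eq_bigr => z _; rewrite rmorphM mulrC.
Qed.

Lemma kadjK I J (F : I -> J -> C) : kadj (kadj F) = F.
Proof. by apply/funext => x; apply/funext => y; rewrite /kadj conjCK. Qed.

Lemma ktrC I J (F : I -> J -> C) (G : J -> I -> C) : ktr (F ** G) = ktr (G ** F).
Proof.
rewrite /ktr /kmul exchange_big; apply: eq_bigr => y _.
by apply: eq_bigr => x _; rewrite mulrC.
Qed.

Lemma ktr_diag_mul I J (p : I -> C) (F : I -> J -> C) (G : J -> I -> C) :
  ktr (kdiag p ** F ** G) = \sum_i \sum_j p i * (F i j * G j i).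
Proof.
rewrite -kmulA /ktr; apply: eq_bigr => i _; rewrite /kmul /kdiag.
under eq_bigr do rewrite -mulrA.
by rewrite sum_delta mulr_sumr.
Qed.

(** The rows of [U] are the conjugated eigenvectors of [F]. The eigenbasis has its own index type
    [K], so both unitarity relations are recorded. *)
Definition diagonalizes I K (F : I -> I -> C) (U : K -> I -> C) (p : K -> C) :=
  [/\ U ** kadj U = @kone K, kadj U ** U = @kone I
    & F = kadj U ** kdiag p ** U].

(** * Variational formula for the quasi-entropies [Q_t] *)

Section QuasiEntropy.
Variables (I K L : finType) (rho sigma : I -> I -> C).
Variables (U : K -> I -> C) (p : K -> C) (W : L -> I -> C) (s : L -> C).
Hypotheses (rhoU : diagonalizes rho U p) (sigmaW : diagonalizes sigma W s).
Hypotheses (p_ge0 : forall k, 0 <= p k) (s_ge0 : forall l, 0 <= s l).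

Definition overlap : K -> L -> C := U ** kadj W.

Definition qform t (X : I -> I -> C) : C :=
  ktr (rho ** X) + (ktr (rho ** X))^*
  - t * ktr (rho ** (X ** kadj X)) - ktr (sigma ** (kadj X ** X)).

(** The inner product of [rho] with its image under the inverse of [X |-> t rho X + X sigma], a map
    with eigenvalues [t p_k + s_l] in the mixed eigenbases. Terms with zero denominator vanish, by
    the convention [x / 0 = 0]. *)
Definition quasi t : C :=
  \sum_k \sum_l `|overlap k l| ^+ 2 * (p k ^+ 2 / (t * p k + s l)).

(** In the mixed coordinates [Y k l] both quadratic terms are diagonal, so the functional splits
    into one scalar quadratic per pair [(k, l)]. *)
Lemma qformE t X : let Y := U ** X ** kadj W in
  qform t X = \sum_k \sum_l
    (p k * (Y k l * (overlap k l)^* + (Y k l)^* * overlap k l)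
     - (t * p k + s l) * (Y k l * (Y k l)^*)).
Proof.
case: rhoU sigmaW => UU1 U1 rE [WW1 W1 sE] Y.
have e1 : ktr (rho ** X) = \sum_k \sum_l p k * (Y k l * (overlap k l)^*).
  have -> : ktr (rho ** X) = ktr (kdiag p ** Y ** kadj overlap).
    rewrite rE -!kmulA ktrC /overlap kadjM kadjK /Y -!kmulA.
    by rewrite (kmulA (kadj W)) W1 kmul1k.
  by rewrite ktr_diag_mul; apply: eq_bigr => k _; apply: eq_bigr.
have e2 : ktr (rho ** (X ** kadj X)) = \sum_k \sum_l p k * (Y k l * (Y k l)^*).
  have -> : ktr (rho ** (X ** kadj X)) = ktr (kdiag p ** Y ** kadj Y).
    rewrite rE -!kmulA ktrC /Y !kadjM kadjK -!kmulA.
    by rewrite (kmulA (kadj W)) W1 kmul1k.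
  by rewrite ktr_diag_mul; apply: eq_bigr => k _; apply: eq_bigr.
have e3 : ktr (sigma ** (kadj X ** X)) =
    \sum_k \sum_l s l * (Y k l * (Y k l)^*).
  have -> : ktr (sigma ** (kadj X ** X)) = ktr (kdiag s ** kadj Y ** Y).
    rewrite sE -!kmulA ktrC /Y !kadjM kadjK -!kmulA.
    by rewrite (kmulA (kadj U)) U1 kmul1k.
  rewrite ktr_diag_mul exchange_big; apply: eq_bigr => k _.
  by apply: eq_bigr => l _; rewrite /kadj [_^* * _]mulrC.
rewrite /qform e1 e2 e3 rmorph_sum mulr_sumr -big_split /= -!sumrB.
apply: eq_bigr => k _; rewrite rmorph_sum mulr_sumr -big_split /= -!sumrB.
apply: eq_bigr => l _; rewrite !rmorphM /= conjCK (conj_Creal (ger0_real (p_ge0 k))).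
by ring.
Qed.

Lemma qform_le_quasi t X : 0 < t -> qform t X <= quasi t.
Proof.
move=> t0; rewrite qformE; apply: ler_sum => k _; apply: ler_sum => l _.
set y := (U ** _ ** _) k l; set g := overlap k l.
(* A zero denominator forces [p k = 0]: the right side vanishes and the left side is at most
   zero. *)
have [d0|dn0] := eqVneq (t * p k + s l) 0.
  have pk0 : p k = 0.
    move/eqP: d0; rewrite paddr_eq0 ?mulr_ge0 ?(ltW t0) //.
    by case/andP; rewrite mulf_eq0 gt_eqF //= => /eqP.
  rewrite pk0.
  by rewrite mulr0 add0r !mul0r expr0n /= mul0r mulr0 subr_le0 mulr_ge0 ?mul_conjC_ge0.
have d_gt0 : 0 < t * p k + s l.
  by rewrite lt_def dn0 addr_ge0 ?mulr_ge0 // ltW.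
set d := t * p k + s l in dn0 d_gt0 *.
have dr : d^* = d by rewrite conj_Creal ?gtr0_real.
have pr : (p k)^* = p k by rewrite conj_Creal ?ger0_real.
rewrite -subr_ge0 normCK.
(* Completing the square: the deficit is [d] times the squared modulus of [y - p k * g / d]. *)
suff -> : g * g^* * (p k ^+ 2 / d) - (p k * (y * g^* + y^* * g) - d * (y * y^*))
   = d * ((y - p k * g / d) * (y - p k * g / d)^*).
  by rewrite mulr_ge0 ?mul_conjC_ge0 // ltW.
by rewrite rmorphB !rmorphM fmorphV /= dr pr; field.
Qed.

Lemma qform_attains_quasi t : 0 < t -> exists X, qform t X = quasi t.
Proof.
move=> t0; case: rhoU sigmaW => UU1 U1 rE [WW1 W1 sE].
(* The stationary point of each scalar quadratic, then carried back from the mixed eigenbases. *)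
pose Y k l := p k * overlap k l / (t * p k + s l).
exists (kadj U ** Y ** W); rewrite qformE.
apply: eq_bigr => k _; apply: eq_bigr => l _.
have -> : U ** (kadj U ** Y ** W) ** kadj W = Y.
  by rewrite !kmulA UU1 kmul1k -kmulA WW1 kmulk1.
set g := overlap k l; rewrite /Y -/g.
have [d0|dn0] := eqVneq (t * p k + s l) 0.
  by rewrite d0 invr0 !mulr0 rmorph0 !mul0r addr0 !mulr0 subr0.
have dr : (t * p k + s l)^* = t * p k + s l.
  by rewrite conj_Creal ?ger0_real ?addr_ge0 ?mulr_ge0 // ltW.
have pr : (p k)^* = p k by rewrite conj_Creal ?ger0_real.
by rewrite normCK !rmorphM fmorphV /= dr pr; field.
Qed.

End QuasiEntropy.

(** [iota] is an embedding of operators dual to the reduction of states. Being multiplicative and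
    compatible with adjoints it preserves [qform], so a maximizer for the small pair is a competitor
    for the large one. *)
Lemma quasi_mono I K L (rho sigma : I -> I -> C) (U : K -> I -> C) p
    (W : L -> I -> C) s I' K' L' (rho' sigma' : I' -> I' -> C)
    (U' : K' -> I' -> C) p' (W' : L' -> I' -> C) s'
    (iota : (I' -> I' -> C) -> (I -> I -> C)) t :
  diagonalizes rho U p -> diagonalizes sigma W s ->
  (forall k, 0 <= p k) -> (forall l, 0 <= s l) ->
  diagonalizes rho' U' p' -> diagonalizes sigma' W' s' ->
  (forall k, 0 <= p' k) -> (forall l, 0 <= s' l) ->
  (forall X Y, iota (X ** Y) = iota X ** iota Y) ->
  (forall X, iota (kadj X) = kadj (iota X)) ->
  (forall X, ktr (rho ** iota X) = ktr (rho' ** X)) ->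
  (forall X, ktr (sigma ** iota X) = ktr (sigma' ** X)) ->
  0 < t ->
  quasi U' p' W' s' t <= quasi U p W s t.
Proof.
move=> rU sW p0 s0 rU' sW' p0' s0' iM iA tr_r tr_s t0.
have [X <-] := qform_attains_quasi rU' sW' p0' s0' t0.
apply: le_trans (qform_le_quasi rU sW p0 s0 (iota X) t0).
by rewrite /qform -iA -!iM !tr_r !tr_s.
Qed.

End Kernels.

(** * From resolvents to logarithms *)

Section LogSum.
Local Open Scope classical_set_scope.
Variable R : realType.

Lemma is_derive_bigsum (I : Type) (r : seq I) (h : I -> R -> R) (dh : I -> R) (x : R) :
  (forall i, is_derive x 1 (h i) (dh i)) ->
  is_derive x 1 (fun t => \sum_(i <- r) h i t) (\sum_(i <- r) dh i).
Proof.
move=> hd; elim: r => [|i r IH].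
  rewrite big_nil; have -> : (fun t => \sum_(i <- [::]) h i t) = cst 0.
    by apply/funext => t; rewrite big_nil.
  exact: is_derive_cst.
rewrite big_cons; have -> : (fun t => \sum_(i <- i :: r) h i t) =
    h i + (fun t => \sum_(i <- r) h i t).
  by apply/funext => t; rewrite big_cons.
exact: is_deriveD.
Qed.

Lemma cvg_bigsum (T : Type) (F : set_system T) (FF : Filter F) (I : Type)
    (r : seq I) (f : I -> T -> R) (l : I -> R) :
  (forall i, f i x @[x --> F] --> l i) ->
  \sum_(i <- r) f i x @[x --> F] --> \sum_(i <- r) l i.
Proof. by move=> h; apply: cvg_big => //; exact: add_continuous. Qed.

(** A primitive in [t] of the weighted resolvents, normalised to vanish at [t = 0]. For the weights
    [|g_kl|^2 p_k] its derivative is [Q_t]. *)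
Definition logsum (I : finType) (m p s : I -> R) t :=
  \sum_i m i * (ln (t * p i + s i) - ln (s i)).

Lemma is_derive_logsum (I : finType) (m p s : I -> R) (t : R) :
  (forall i, 0 <= p i) -> (forall i, m i != 0 -> 0 < s i) -> 0 <= t ->
  is_derive t 1 (logsum m p s) (\sum_i m i * (p i / (t * p i + s i))).
Proof.
move=> p0 s0 t0; apply: is_derive_bigsum => i.
have [mi0|mi0] := eqVneq (m i) 0.
  have -> : (fun u => m i * (ln (u * p i + s i) - ln (s i))) = cst 0.
    by apply/funext => u; rewrite mi0 mul0r.
  by rewrite mi0 mul0r; exact: is_derive_cst.
have q0 : 0 < t * p i + s i by rewrite ltr_wpDl ?mulr_ge0 // s0.
have dq : is_derive t 1 (fun u : R => u * p i + s i) (p i).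
  have -> : (fun u : R => u * p i + s i) = (p i) *: (@id R) + cst (s i).
    by apply/funext => u; rewrite /= mulrC.
  apply: is_derive_eq; by rewrite addr0 /GRing.scale /= mulr1.
have dl : is_derive t 1 (@ln R \o (fun u : R => u * p i + s i))
    ((t * p i + s i)^-1 * p i).
  have dln := @is_derive1_ln R _ q0.
  exact: is_derive1_comp.
have -> : (fun u => m i * (ln (u * p i + s i) - ln (s i))) =
   m i *: ((@ln R \o (fun u : R => u * p i + s i)) - cst (ln (s i))).
  by apply/funext.
by apply: is_derive_eq; rewrite subr0 mulrC.
Qed.

Lemma logsum0 (I : finType) (m p s : I -> R) : logsum m p s 0 = 0.
Proof. by apply: big1 => i _; rewrite mul0r add0r subrr mulr0. Qed.

(** With [t = e^-1] one has [ln (t * p + s) = ln (p + e * s) - ln e], and the added multiple of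
    [ln e] cancels the divergence. *)
Lemma logsum_cvg (I : finType) (m p s : I -> R) :
  (forall i, 0 <= s i) -> (forall i, m i != 0 -> 0 < p i /\ 0 < s i) ->
  logsum m p s e^-1 + (\sum_i m i) * ln e @[e --> 0^'+] -->
    \sum_i m i * (ln (p i) - ln (s i)).
Proof.
move=> s0 ps0.
have h : \sum_i m i * (ln (p i + e * s i) - ln (s i)) @[e --> 0^'+] -->
    \sum_i m i * (ln (p i) - ln (s i)).
  apply: cvg_bigsum => i.
  have [mi0|mi0] := eqVneq (m i) 0.
    rewrite mi0 mul0r; under eq_fun do rewrite mul0r.
    exact: cvg_cst.
  have [pi0 si0] := ps0 _ mi0.
  apply: cvgM; first exact: cvg_cst.
  apply: cvgB; last exact: cvg_cst.
  have hp : p i + e * s i @[e --> 0^'+] --> p i + 0 * s i.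
    apply: cvgD; first exact: cvg_cst.
    by apply: cvgM; [exact: cvg_within|exact: cvg_cst].
  rewrite mul0r addr0 in hp.
  by apply: continuous_cvg => //; exact: continuous_ln.
apply: cvg_trans h; apply: near_eq_cvg; near=> e.
have e0 : 0 < e by near: e; exact: nbhs_right_gt.
rewrite /logsum mulr_suml -big_split; apply: eq_bigr => i _ /=.
have [->|mi0] := eqVneq (m i) 0; first by rewrite !mul0r addr0.
have [pi0 si0] := ps0 _ mi0.
have -> : e^-1 * p i + s i = (p i + e * s i) / e by field; rewrite gt_eqF.
rewrite ln_div ?posrE //; last by rewrite addr_gt0 // mulr_gt0.
by ring.
Unshelve. all: by end_near.
Qed.

(** The difference of the two [logsum] functions vanishes at 0 and has nonnegative derivative, so it
    is nonnegative at every [t = e^-1]; then [e] tends to 0. *)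
Lemma logsum_mono (I J : finType) (m p s : I -> R) (m' p' s' : J -> R) :
  (forall i, 0 <= p i) -> (forall i, 0 <= s i) ->
  (forall i, m i != 0 -> 0 < p i /\ 0 < s i) ->
  (forall i, 0 <= p' i) -> (forall i, 0 <= s' i) ->
  (forall i, m' i != 0 -> 0 < p' i /\ 0 < s' i) ->
  \sum_i m i = \sum_i m' i ->
  (forall t, 0 < t -> \sum_i m' i * (p' i / (t * p' i + s' i)) <=
                      \sum_i m i * (p i / (t * p i + s i))) ->
  \sum_i m' i * (ln (p' i) - ln (s' i)) <= \sum_i m i * (ln (p i) - ln (s i)).
Proof.
move=> p0 s0 ps0 p0' s0' ps0' mm' hle.
apply: (ler_cvg_to (logsum_cvg s0' ps0') (logsum_cvg s0 ps0)).
(* Equal total weights make the two divergent corrections identical. *)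
near=> e; rewrite mm' lerD2r.
have e0 : 0 < e^-1 by rewrite invr_gt0; near: e; exact: nbhs_right_gt.
pose df t := \sum_i m i * (p i / (t * p i + s i))
    - \sum_i m' i * (p' i / (t * p' i + s' i)).
have dD (t : R) : 0 <= t ->
    is_derive t 1 (logsum m p s - logsum m' p' s') (df t).
  move=> t0; apply: is_deriveB; apply: is_derive_logsum => // i.
    by move=> /ps0[].
  by move=> /ps0'[].
have cD : {within `[0, e^-1], continuous (logsum m p s - logsum m' p' s')}.
  apply: derivable_within_continuous => x.
  by rewrite in_itv /= => /andP[x0 _]; have [] := dD _ x0.
have dD' x : x \in `]0, e^-1[%R -> is_derive x 1 (logsum m p s - logsum m' p' s') (df x).
  by rewrite in_itv /= => /andP[/ltW x0 _]; exact: dD.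
have [t] := MVT e0 dD' cD.
rewrite in_itv /= => /andP[t0 _].
rewrite subr0 => hD; rewrite -subr_ge0.
have -> : logsum m p s e^-1 - logsum m' p' s' e^-1 =
   (logsum m p s - logsum m' p' s') e^-1 - (logsum m p s - logsum m' p' s') 0.
  by rewrite /= !fctE !logsum0 subr0 subr0.
by rewrite hD mulr_ge0 ?(ltW e0) // subr_ge0 hle.
Unshelve. all: by end_near.
Qed.
End LogSum.

(** * Strong subadditivity *)

Local Infix "**" := kmul (at level 40, left associativity).

(** * Amplifications and partial traces *)

Section Tensor.
Variable C : numClosedFieldType.
Implicit Types A B I J K L : finType.

(** The operator [1_A (x) F]; [F] may be rectangular, so that eigenvector matrices are amplified
    too. *)
Definition amp A I J (F : I -> J -> C) : A * I -> A * J -> C :=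
  fun x y => (x.1 == y.1)%:R * F x.2 y.2.

Definition ptrace A I (F : A * I -> A * I -> C) : I -> I -> C :=
  fun x y => \sum_a F (a, x) (a, y).

(* [mid_amp X] is [X (x) 1_B], with the factor B inserted in the middle. *)
Definition mid_amp A B I (X : A * I -> A * I -> C) :
    A * (B * I) -> A * (B * I) -> C :=
  fun x y => (x.2.1 == y.2.1)%:R * X (x.1, x.2.2) (y.1, y.2.2).

Definition mid_ptrace A B I (F : A * (B * I) -> A * (B * I) -> C) :
    A * I -> A * I -> C :=
  fun x y => \sum_b F (x.1, (b, x.2)) (y.1, (b, y.2)).

Lemma amp_mulE A I J K (F : I -> J -> C) (G : A * J -> K -> C) a i k :
  (amp F ** G) (a, i) k = \sum_j F i j * G (a, j) k.
Proof.
rewrite /kmul sum_pair /amp /=.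
rewrite -[RHS](sum_delta a (fun a' => \sum_j F i j * G (a', j) k)).
apply: eq_bigr => a' _; rewrite mulr_sumr.
by apply: eq_bigr => j _; rewrite mulrA.
Qed.

Lemma ampM A I J K (F : I -> J -> C) (G : J -> K -> C) :
  @amp A _ _ (F ** G) = amp F ** amp G.
Proof.
apply/funext => -[a i]; apply/funext => -[b k]; rewrite amp_mulE /amp /kmul.
by rewrite mulr_sumr; apply: eq_bigr => j _ /=; rewrite mulrCA.
Qed.

Lemma amp_adj A I J (F : I -> J -> C) : @amp A _ _ (kadj F) = kadj (amp F).
Proof.
apply/funext => x; apply/funext => y.
by rewrite /kadj /amp rmorphM rmorph_nat eq_sym.
Qed.

Lemma amp_diag A I (p : I -> C) :
  @amp A _ _ (kdiag p) = kdiag (fun x => p x.2).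
Proof.
apply/funext => -[a i]; apply/funext => -[b j]; rewrite /kdiag /amp /=.
by rewrite mulrA -natrM mulnb.
Qed.

Lemma kone_diag I : @kone C I = kdiag (fun=> 1).
Proof. by apply/funext => x; apply/funext => y; rewrite /kdiag mulr1. Qed.

Lemma amp_diagonalizes A I K (F : I -> I -> C) (U : K -> I -> C) p :
  diagonalizes F U p ->
  diagonalizes (@amp A _ _ F) (amp U) (fun k => p k.2).
Proof.
case=> UU1 U1 ->; split.
- by rewrite -amp_adj -ampM UU1 !kone_diag amp_diag.
- by rewrite -amp_adj -ampM U1 !kone_diag amp_diag.
- by rewrite !ampM amp_diag amp_adj.
Qed.

Lemma mid_ampM A B I (X Y : A * I -> A * I -> C) :
  @mid_amp A B I (X ** Y) = mid_amp X ** mid_amp Y.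
Proof.
apply/funext => -[a [b i]]; apply/funext => -[a' [b' i']].
rewrite /mid_amp /kmul /= !sum_pair mulr_sumr; apply: eq_bigr => c _.
rewrite sum_pair exchange_big mulr_sumr; apply: eq_bigr => j _ /=.
under eq_bigr do rewrite -!mulrA.
by rewrite sum_delta; ring.
Qed.

Lemma mid_amp_adj A B I (X : A * I -> A * I -> C) :
  @mid_amp A B I (kadj X) = kadj (mid_amp X).
Proof.
apply/funext => x; apply/funext => y.
by rewrite /kadj /mid_amp rmorphM rmorph_nat eq_sym.
Qed.

(** Duality of [X |-> X (x) 1_B] and the partial trace over B, as [quasi_mono] asks for. *)
Lemma ktr_mid_amp A B I (F : A * (B * I) -> A * (B * I) -> C) X :
  ktr (F ** mid_amp X) = ktr (mid_ptrace F ** X).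
Proof.
rewrite /ktr /kmul !sum_pair; apply: eq_bigr => a _.
rewrite sum_pair exchange_big; apply: eq_bigr => i _.
under [RHS]eq_bigr do rewrite /mid_ptrace mulr_suml.
rewrite [RHS]exchange_big; apply: eq_bigr => b _ /=.
rewrite !sum_pair; apply: eq_bigr => a' _.
rewrite sum_pair exchange_big; apply: eq_bigr => i' _ /=.
rewrite /mid_amp /=.
under eq_bigr => b' _ do rewrite eq_sym mulrCA.
by rewrite sum_delta.
Qed.

Lemma ktr_mid_ptrace A B I (F : A * (B * I) -> A * (B * I) -> C) :
  ktr (mid_ptrace F) = ktr F.
Proof.
rewrite /ktr !sum_pair; apply: eq_bigr => a _.
by rewrite sum_pair exchange_big.
Qed.

(** Tracing B out of [1_A (x) rho_BR] leaves [1_A (x) rho_R], so the reduced reference operator has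
    the same form. *)
Lemma mid_ptrace_amp A B I (F : B * I -> B * I -> C) :
  mid_ptrace (@amp A _ _ F) = amp (ptrace F).
Proof.
by apply/funext => x; apply/funext => y; rewrite /mid_ptrace /amp mulr_sumr.
Qed.

(** Links overlap weights to the reduced spectrum: when [W] is an eigenbasis of [ptrace F], the
    right side is an eigenvalue. *)
Lemma ptrace_amp_conj A I L (F : A * I -> A * I -> C) (W : L -> I -> C) l :
  \sum_a (amp W ** F ** kadj (amp W)) (a, l) (a, l) =
  (W ** ptrace F ** kadj W) l l.
Proof.
have -> : (W ** ptrace F ** kadj W) l l =
   \sum_a \sum_i \sum_j W l i * F (a, i) (a, j) * (W l j)^*.
  rewrite -kmulA [RHS]exchange_big; apply: eq_bigr => i _.
  rewrite [RHS]exchange_big mulr_sumr; apply: eq_bigr => j _ /=.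
  by rewrite /ptrace mulr_suml mulr_sumr; apply: eq_bigr => a _; rewrite mulrA.
apply: eq_bigr => a _; rewrite -kmulA amp_mulE; apply: eq_bigr => i _.
rewrite /kmul sum_pair exchange_big mulr_sumr; apply: eq_bigr => j _ /=.
rewrite /kadj /amp /=.
under eq_bigr => b _ do rewrite rmorphM rmorph_nat mulrCA.
by rewrite sum_delta mulrA.
Qed.

End Tensor.

(** * Monotonicity of the relative entropy and strong subadditivity *)

Section SSA.
Variable R : realType.
Local Notation C := (R[i]).
Implicit Types A B I J K L : finType.

(** A relation rather than a function: any diagonalization over any index type is a witness, so
    entropies can be carried along bijections. *)
Definition has_entropy I (F : I -> I -> C) (e : R) :=
  exists (K : finType) (U : K -> I -> C) (p : K -> R),
    [/\ diagonalizes F U (fun k => (p k)%:C%C), forall k, 0 <= p k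
      & e = - \sum_k p k * ln (p k)].

Definition nsq (z : C) : R := complex.Re z ^+ 2 + complex.Im z ^+ 2.

Lemma nsqE z : (nsq z)%:C%C = `|z| ^+ 2.
Proof. by rewrite normc_def -rmorphXn sqr_sqrtr // addr_ge0 ?sqr_ge0. Qed.

Lemma nsq_ge0 z : 0 <= nsq z.
Proof. by rewrite addr_ge0 ?sqr_ge0. Qed.

Lemma nsq_overlap_sum I K L (U : K -> I -> C) (W : L -> I -> C) k :
  U ** kadj U = @kone _ K -> kadj W ** W = @kone _ I ->
  \sum_l nsq (overlap U W k l) = 1.
Proof.
move=> U1 W1; apply: (@complexI R); rewrite rmorph_sum rmorph1.
have : (overlap U W ** kadj (overlap U W)) k k = 1.
  rewrite /overlap kadjM kadjK -kmulA (kmulA (kadj W)) W1 kmul1k U1.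
  by rewrite /kone eqxx.
by move=> <-; apply: eq_bigr => l _; rewrite /= nsqE normCK.
Qed.

Lemma nsq_overlap_conj I K L (F : I -> I -> C) (U : K -> I -> C) p
    (W : L -> I -> C) l :
  diagonalizes F U (fun k => (p k)%:C%C) ->
  (\sum_k nsq (overlap U W k l) * p k)%:C%C = (W ** F ** kadj W) l l.
Proof.
case=> _ _ ->.
have -> : W ** (kadj U ** kdiag (fun k => (p k)%:C%C) ** U) ** kadj W =
   kadj (overlap U W) ** (kdiag (fun k => (p k)%:C%C) ** overlap U W).
  by rewrite /overlap kadjM kadjK !kmulA.
rewrite rmorph_sum; apply: eq_bigr => k _.
rewrite /kmul /kdiag; under [in RHS]eq_bigr do rewrite -mulrA.
by rewrite sum_delta rmorphM /= nsqE normCK /kadj; ring.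
Qed.

Lemma ktr_diagonalizes I K (F : I -> I -> C) (U : K -> I -> C) p :
  diagonalizes F U (fun k => (p k)%:C%C) -> ktr F = (\sum_k p k)%:C%C.
Proof.
case=> UU1 U1 ->; rewrite -kmulA ktrC -kmulA UU1 kmulk1 rmorph_sum.
by apply: eq_bigr => k _; rewrite /kdiag eqxx mul1r.
Qed.

(** One factor of [p ^+ 2] moves into the weight, which gives the derivative of [logsum] over pairs
    [(k, l)]. *)
Lemma quasi_real I K L (U : K -> I -> C) p (W : L -> I -> C) s (t : R) :
  quasi U (fun k => (p k)%:C%C) W (fun l => (s l)%:C%C) t%:C%C =
  (\sum_(kl : K * L) nsq (overlap U W kl.1 kl.2) * p kl.1 *
     (p kl.1 / (t * p kl.1 + s kl.2)))%:C%C.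
Proof.
rewrite sum_pair rmorph_sum; apply: eq_bigr => k _.
rewrite rmorph_sum; apply: eq_bigr => l _ /=.
by rewrite !rmorphM fmorphV /= nsqE rmorphD rmorphM /=; ring.
Qed.

(* Since [sum_(k, a) m (k, (a, l)) = s l], the weight [m] vanishes where [s]
   does, so the junk value [ln 0 = 0] never contributes. *)
Lemma entropy_logsum A J K L (F : A * J -> A * J -> C) (U : K -> A * J -> C) p
    (W : L -> J -> C) s
    (m := fun kl : K * (A * L) => nsq (overlap U (amp W) kl.1 kl.2) * p kl.1) :
  diagonalizes F U (fun k => (p k)%:C%C) ->
  diagonalizes (ptrace F) W (fun k => (s k)%:C%C) ->
  (forall k, 0 <= p k) -> (forall k, 0 <= s k) ->
  [/\ forall kl, m kl != 0 -> 0 < p kl.1 /\ 0 < s kl.2.2,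
      (\sum_kl m kl)%:C%C = ktr F
    & \sum_kl m kl * (ln (p kl.1) - ln (s kl.2.2)) =
      \sum_k p k * ln (p k) - \sum_l s l * ln (s l)].
Proof.
move=> FU GW p0 s0.
have [UU1 U1 FE] := FU; have [WW1 W1 GE] := GW.
have [AA1 A1 _] := @amp_diagonalizes _ A _ _ _ _ _ GW.
have m0 kl : 0 <= m kl by rewrite mulr_ge0 ?nsq_ge0.
(* First marginal of [m]: the rows of the overlap kernel are unit vectors. *)
have m_k k : \sum_al m (k, al) = p k.
  by rewrite /m /= -mulr_suml nsq_overlap_sum ?mul1r.
(* Second marginal: the weights at fixed [l] add up to a diagonal entry of the reduced operator in
   its own eigenbasis. *)
have m_l l : \sum_a \sum_k m (k, (a, l)) = s l.
  apply: (@complexI R); rewrite rmorph_sum.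
  transitivity (\sum_a (amp W ** F ** kadj (amp W)) (a, l) (a, l)).
    by apply: eq_bigr => a _; rewrite -(nsq_overlap_conj _ _ FU).
  rewrite ptrace_amp_conj GE.
  have -> : W ** (kadj W ** kdiag (fun k => (s k)%:C%C) ** W) ** kadj W =
      kdiag (fun k => (s k)%:C%C).
    by rewrite !kmulA WW1 kmul1k -kmulA WW1 kmulk1.
  by rewrite /kdiag eqxx mul1r.
split.
- move=> [k [a l]] mn0 /=; split.
    rewrite lt_def p0 andbT; apply: contraNN mn0 => /eqP pk0.
    by rewrite /m /= pk0 mulr0.
  rewrite lt_def s0 andbT; apply: contraNN mn0 => /eqP sl0.
  have /eqP := m_l l; rewrite sl0 psumr_eq0; last first.
    by move=> b _; apply: sumr_ge0.
  move=> /allP /(_ a (mem_index_enum _)) /=; rewrite psumr_eq0 //.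
  by move=> /allP /(_ k (mem_index_enum _)).
- rewrite (ktr_diagonalizes FU) sum_pair.
  by under eq_bigr => k _ do rewrite m_k.
under eq_bigr do rewrite mulrBr.
rewrite sumrB; congr (_ - _).
  rewrite sum_pair; apply: eq_bigr => k _.
  by rewrite /= -mulr_suml m_k.
rewrite sum_pair exchange_big sum_pair exchange_big; apply: eq_bigr => l _.
rewrite /= -m_l mulr_suml; apply: eq_bigr => a _.
by rewrite mulr_suml.
Qed.

(** For the pair [F], [1_A (x) ptrace F] the relative entropy is [e23 - e123]; after tracing out B
    it is [e3 - e13]. *)
Theorem strong_subadditivity A B I (F : A * (B * I) -> A * (B * I) -> C)
    e123 e23 e13 e3 :
  has_entropy F e123 -> has_entropy (ptrace F) e23 ->
  has_entropy (mid_ptrace F) e13 -> has_entropy (ptrace (ptrace F)) e3 ->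
  e123 + e3 <= e13 + e23.
Proof.
move=> [K [U [p [FU p0 ->]]]] [L [W [s [GW s0 ->]]]].
move=> [K' [U' [p' [FU' p0' ->]]]] [L' [W' [s' [GW' s0' ->]]]].
(* The order of the two partial traces is immaterial, so [GW'] also diagonalizes the reduction of
   the AR state. *)
have pt : ptrace (mid_ptrace F) = ptrace (ptrace F).
  by apply/funext => x; apply/funext => y; rewrite /ptrace /mid_ptrace exchange_big.
rewrite -pt in GW'.
have [ps mtr mE] := entropy_logsum FU GW p0 s0.
have [ps' mtr' mE'] := entropy_logsum FU' GW' p0' s0'.
have : \sum_k' p' k' * ln (p' k') - \sum_l' s' l' * ln (s' l') <=
       \sum_k p k * ln (p k) - \sum_l s l * ln (s l).
  rewrite -mE -mE'.
  apply: (@logsum_mono R _ _ _ (fun kl => p kl.1) (fun kl => s kl.2.2)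
    _ (fun kl => p' kl.1) (fun kl => s' kl.2.2)) => // [|t t0].
    (* The total weight on each side is the trace, which the partial trace preserves. *)
    by apply: (@complexI R); rewrite mtr mtr' ktr_mid_ptrace.
  suff : quasi U' (fun k => (p' k)%:C%C) (amp W') (fun l => (s' l.2)%:C%C) t%:C%C
      <= quasi U (fun k => (p k)%:C%C) (amp W) (fun l => (s l.2)%:C%C) t%:C%C.
    by rewrite (quasi_real U p (amp W) (fun l => s l.2))
      (quasi_real U' p' (amp W') (fun l => s' l.2)) lecR.
  have geC (T : finType) (f : T -> R) : (forall x, 0 <= f x) ->
    forall x, 0 <= (f x)%:C%C by move=> f0 x; rewrite lecR.
  apply: (quasi_mono (iota := @mid_amp _ A B I)
    FU (@amp_diagonalizes _ A _ _ _ _ _ GW) (geC _ _ p0) (fun l => geC _ _ s0 l.2)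
    FU' (@amp_diagonalizes _ A _ _ _ _ _ GW') (geC _ _ p0')
    (fun l => geC _ _ s0' l.2)).
  - exact: mid_ampM.
  - exact: mid_amp_adj.
  - exact: ktr_mid_amp.
  - by move=> X; rewrite ktr_mid_amp mid_ptrace_amp pt.
  - by rewrite ltcR.
lra.
Qed.
End SSA.

(** * Reindexing and subadditivity *)

Section Subadditivity.
Variable R : realType.
Local Notation C := (R[i]).
Implicit Types A B I J K L : finType.

Lemma has_entropy_reindex I J (F : I -> I -> C) (f : J -> I) e :
  bijective f -> has_entropy F e ->
  has_entropy (fun x y => F (f x) (f y)) e.
Proof.
move=> bf [K [U [p [[UU1 U1 FE] p0 eE]]]].
exists K, (fun k x => U k (f x)), p; split=> //; split.
- rewrite -UU1; apply/funext => k; apply/funext => l.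
  by rewrite /kmul [RHS](reindex f) //; apply: onW_bij.
- apply/funext => x; apply/funext => y.
  have := congr1 (fun G => G (f x) (f y)) U1.
  by rewrite /kone (inj_eq (bij_inj bf)).
- by rewrite FE.
Qed.

Lemma has_entropy_unit (F : unit -> unit -> C) : F tt tt = 1 -> has_entropy F 0.
Proof.
move=> F1; exists unit, (@kone C unit), (fun=> 1); split=> //; last first.
  by rewrite big1 ?oppr0 // => k _; rewrite ln1 mulr0.
have adj1 : kadj (@kone C unit) = @kone C unit.
  by apply/funext => x; apply/funext => y; rewrite /kadj /kone rmorph_nat eq_sym.
split; rewrite adj1 ?kmul1k // -kone_diag kmulk1.
by apply/funext => -[]; apply/funext => -[]; rewrite F1.
Qed.

(** Strong subadditivity with a one-dimensional third system, encoded by [unit]; trace one makes its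
    entropy zero. *)
Lemma subadditivity A B (F : A * B -> A * B -> C) e12 e1 e2 :
  ktr F = 1 -> has_entropy F e12 ->
  has_entropy (fun a a' => \sum_b F (a, b) (a', b)) e1 ->
  has_entropy (ptrace F) e2 -> e12 <= e1 + e2.
Proof.
move=> F1 h12 h1 h2.
have bij_fst T : bijective (fun x : T * unit => x.1).
  by exists (fun x => (x, tt)) => // -[x []].
have bij12 : bijective (fun x : A * (B * unit) => (x.1, x.2.1)).
  by exists (fun x => (x.1, (x.2, tt))) => [[x [y []]]|[x y]].
have := strong_subadditivity (has_entropy_reindex bij12 h12)
  (has_entropy_reindex (bij_fst B) h2) (has_entropy_reindex (bij_fst A) h1)
  (has_entropy_unit _).
rewrite addr0; apply.
rewrite -F1 /ktr sum_pair exchange_big; apply: eq_bigr => b _.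
by [].
Qed.

End Subadditivity.

(** * Spectral data and the limit of Tsallis entropies *)

Section Spectral.
Variable R : realType.
Local Notation C := (R[i]).

(** Polarization: the form is real at [e_i], [e_j], [e_i + e_j] and [e_i + 'i e_j], which determines
    the sum and the difference of the conjugated off-diagonal entries. *)
Lemma psd_conj n (M : 'M[C]_n) i j : psd M -> (M j i)^* = M i j.
Proof.
move=> psdM.
have form (a b : C) : 0 <= a^* * (M i i * a + M i j * b)
                         + b^* * (M j i * a + M j j * b).
  have := psdM (fun x => (i == x)%:R * a + (j == x)%:R * b).
  congr (_ <= _).
  have row x : \sum_y M x y * ((i == y)%:R * a + (j == y)%:R * b) =
      M x i * a + M x j * b.
    under eq_bigr do rewrite mulrDr !(mulrCA (M x _)).
    by rewrite big_split /= !sum_delta.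
  transitivity (\sum_x ((i == x)%:R * (a^* * (M x i * a + M x j * b))
      + (j == x)%:R * (b^* * (M x i * a + M x j * b)))).
    apply: eq_bigr => x _; under eq_bigr do rewrite -mulrA.
    rewrite -mulr_sumr row rmorphD !rmorphM !rmorph_nat; ring.
  by rewrite big_split /= !sum_delta.
have real (z : C) : 0 <= z -> z^* = z by move=> /ger0_real /conj_Creal.
have hii := real _ (form 1 0); have hjj := real _ (form 0 1).
have h1 := real _ (form 1 1); have hi := real _ (form 1 'i).
move: hii hjj h1 hi; rewrite !(rmorph1, rmorph0, conjCi, rmorphD, rmorphM, rmorphN).
rewrite /= !(rmorph1, rmorph0, conjCi) !(mulr0, mul0r, addr0, add0r, mulr1, mul1r).
move: (M i i)^* (M j j)^* (M i j)^* (M j i)^* => a b c d -> ->.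
rewrite opprK => h1 hi.
have i2 : ('i : C) * 'i = -1 by rewrite -expr2 sqrCi.
have e1 : c + d = M i j + M j i.
  apply: (addrI (M i i + M j j)).
  by transitivity (M i i + c + (d + M j j)); [ring | rewrite h1; ring].
have e2 : d - c = M i j - M j i.
  apply: (mulfI (neq0Ci C)).
  apply: (addrI (M i i + M j j)).
  transitivity (M i i + c * - 'i + 'i * (d + M j j * - 'i)).
    have -> : M i i + c * - 'i + 'i * (d + M j j * - 'i) =
       M i i + 'i * (d - c) - ('i * 'i) * M j j by ring.
    by rewrite i2; ring.
  rewrite hi.
  have -> : M i i + M i j * 'i + - 'i * (M j i + M j j * 'i) =
       M i i + 'i * (M i j - M j i) - ('i * 'i) * M j j by ring.
  by rewrite i2; ring.
apply: (mulfI (_ : 2%:R != 0 :> C)); first by rewrite pnatr_eq0.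
transitivity ((c + d) + (d - c)); first by ring.
by rewrite e1 e2; ring.
Qed.

Lemma psd_normal n (M : 'M[C]_n) : psd M -> M \is normalmx.
Proof.
move=> psdM; apply: hermitian_normalmx; apply/is_hermitianmxP.
by rewrite expr0 scale1r; apply/matrixP => i j; rewrite !mxE psd_conj.
Qed.

Lemma psd_diagonalizes n (M : 'M[C]_n) : psd M ->
  diagonalizes (fun i j => M i j) (fun k i => spectralmx M k i)
    (fun k => (eigs M k)%:C%C) /\ forall k, 0 <= eigs M k.
Proof.
move=> psdM.
have ME := orthomx_spectralP (psd_normal psdM).
have PU := spectral_unitarymx M.
set P := spectralmx M in ME PU *.
have PP1 := unitarymxP PU; rewrite (invmx_unitary PU) in ME.
set Q := (X in P *m X) in PP1; rewrite -/Q in ME.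
have P1 := mulmx1C PP1.
(* An eigenvalue is the value of the form at its eigenvector, hence nonnegative. *)
have spE k : spectral_diag M 0 k = \sum_i \sum_j P k i * M i j * (P k j)^*.
  have : (P *m M *m Q) k k = spectral_diag M 0 k.
    rewrite {1}ME !mulmxA PP1 mul1mx -mulmxA PP1 mulmx1.
    by rewrite mxE eqxx mulr1n.
  move=> <-; rewrite mxE exchange_big; apply: eq_bigr => j _ /=.
  rewrite mxE mulr_suml; apply: eq_bigr => i _.
  by rewrite !mxE.
have sp_ge0 k : 0 <= spectral_diag M 0 k.
  rewrite spE; have := psdM (fun i => (P k i)^*).
  by under eq_bigr => i _ do under eq_bigr => j _ do rewrite conjCK.
(* Nonnegative complex numbers are real, so the real part in [eigs] loses nothing. *)
have spR k : spectral_diag M 0 k = (eigs M k)%:C%C.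
  by rewrite /eigs RRe_real ?ger0_real.
split; last by move=> k; rewrite -lecR -spR.
split.
- apply/funext => k; apply/funext => l.
  have := congr1 (fun G : 'M[C]_n => G k l) PP1; rewrite !mxE /kone => <-.
  by apply: eq_bigr => i _; rewrite !mxE.
- apply/funext => i; apply/funext => j.
  have := congr1 (fun G : 'M[C]_n => G i j) P1; rewrite !mxE /kone => <-.
  by apply: eq_bigr => k _; rewrite !mxE.
- apply/funext => i; apply/funext => j; rewrite {1}ME mxE.
  apply: eq_bigr => k _; rewrite mul_mx_diag !mxE; congr (_ * _).
  rewrite /kmul; under eq_bigr do rewrite mulrC /kdiag eq_sym -mulrA.
  by rewrite sum_delta mulrC /kadj spR.
Qed.

Lemma psd_has_entropy n (M : 'M[C]_n) : psd M ->
  has_entropy (fun i j => M i j) (vonNeumann M).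
Proof.
move=> /psd_diagonalizes[dM p0].
by exists 'I_n, (fun k i => spectralmx M k i), (eigs M).
Qed.

Lemma sum_eigs n (M : 'M[C]_n) : psd M -> (\sum_i eigs M i)%:C%C = \tr M.
Proof. by move=> /psd_diagonalizes[dM _]; rewrite -(ktr_diagonalizes dM). Qed.

End Spectral.

(** * Tsallis entropies as [q] decreases to 1 *)

Section TsallisLimit.
Local Open Scope classical_set_scope.
Variable R : realType.

(** Moves the right-hand limit at 1 to the punctured neighbourhood of 0 in which derivatives are
    defined. *)
Lemma cvg_sub1_dnbhs : (q - 1 : R) @[q --> (1:R)^'+] --> (0 : R)^'.
Proof.
move=> A [e e0 hA]; exists e => // q qe q1; apply: hA.
  by move: qe; rewrite /ball_ /= sub0r opprB.
by rewrite /= subr_eq0 gt_eqF.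
Qed.

Lemma powR_diff_quotient_cvg (a : R) : 0 <= a ->
  (a `^ q - a) / (q - 1) @[q --> 1^'+] --> a * ln a.
Proof.
rewrite le_eqVlt => /predU1P[<-|a0].
  (* At [a = 0] the quotient is zero for every [q > 1], in agreement with [0 * ln 0 = 0]. *)
  rewrite mul0r; apply: cvg_near_cst; near=> q.
  have q1 : 1 < q by near: q; exact: nbhs_right_gt.
  by rewrite powR0 ?subrr ?mul0r // gt_eqF // (lt_trans _ q1).
have d : is_derive (1 : R) 1 (fun q => a `^ q) (a * ln a).
  have -> : (fun q => a `^ q) = expR \o (ln a *: (@id R)).
    by apply/funext => q; rewrite /powR gt_eqF //= mulrC.
  have d1 : is_derive (1 : R) 1 (ln a *: (@id R)) (ln a).
    by apply: is_derive_eq; rewrite /GRing.scale /= mulr1.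
  have d2 : is_derive ((ln a *: (@id R)) 1) 1 (@expR R) a.
    by apply: is_derive_eq; rewrite [X in expR X]mulr1 lnK ?posrE.
  exact: is_derive1_comp.
have [dv dE] := d.
have quot : h^-1 * (a `^ (h + 1) - a) @[h --> (0:R)^'] --> a * ln a.
  rewrite -dE; move: dv; rewrite /derivable /derive => dv.
  apply: cvg_trans dv; apply: near_eq_cvg; near=> h.
  by rewrite /= /GRing.scale /= mulr1 powRr1 ?ltW.
have := cvg_comp _ _ cvg_sub1_dnbhs quot.
apply: cvg_trans; apply: near_eq_cvg; near=> q.
by rewrite /= subrK mulrC.
Unshelve. all: by end_near.
Qed.

Lemma tsallis_cvg n (M : 'M[R[i]]_n) : density M ->
  tsallis q M @[q --> 1^'+] --> vonNeumann M.
Proof.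
move=> [psdM tr1].
have sum1 : \sum_i eigs M i = 1.
  by apply: (@complexI R); rewrite (sum_eigs psdM) tr1.
have [_ p0] := psd_diagonalizes psdM.
have : - \sum_i (eigs M i `^ q - eigs M i) / (q - 1) @[q --> 1^'+]
    --> vonNeumann M.
  by apply: cvgN; apply: cvg_bigsum => i; exact: powR_diff_quotient_cvg.
apply: cvg_trans; apply: near_eq_cvg; near=> q.
(* The eigenvalues sum to one, so the constant 1 is spread over them and each term becomes a
   difference quotient. *)
rewrite /tsallis /trpow -mulr_suml sumrB sum1 -mulrN -invrN opprB.
by [].
Unshelve. all: by end_near.
Qed.

End TsallisLimit.

(** * Relative homology and its integrated Euler characteristic *)

Section Homology.
Implicit Types (J : {set 'I_3}) (G X Y : {set {set 'I_3}}).

(** An all-ones block, of rank at most one. The relative boundary maps in degrees 1 and 2 have this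
    form. *)
Definition outer X Y : 'M['F_2]_NS :=
  \matrix_(i, j) ((sx i \in X) && (sx j \in Y))%:R.

Lemma rank_outer X Y :
  \rank (outer X Y) = ((X != finset.set0) && (Y != finset.set0)).
Proof.
have [->|[J JX]] := set_0Vmem X.
  rewrite eqxx /= [outer _ _](_ : _ = 0) ?mxrank0 //.
  by apply/matrixP => i j; rewrite !mxE inE.
have [->|[K KY]] := set_0Vmem Y.
  rewrite eqxx andbF [outer _ _](_ : _ = 0) ?mxrank0 //.
  by apply/matrixP => i j; rewrite !mxE inE andbF.
have -> : X != finset.set0 by apply/set0Pn; exists J.
have -> : Y != finset.set0 by apply/set0Pn; exists K.
apply/eqP; rewrite eqn_leq lt0n mxrank_eq0; apply/andP; split.
  have -> : outer X Y = \col_i (sx i \in X)%:R *m \row_j (sx j \in Y)%:R.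
    apply/matrixP => i j; rewrite !mxE big_ord1 !mxE.
    by case: (sx i \in X); rewrite ?mul1r ?mul0r.
  exact: mulmx_max_rank.
apply/eqP => /matrixP /(_ (enum_rank J) (enum_rank K)).
by rewrite !mxE /sx !enum_rankK JX KY.
Qed.

Lemma rank_chains G k : \rank (chains G k) = #|relsimp G k|.
Proof.
(* The columns of [A] are the unit vectors of the simplices; they are orthonormal, so [A *m A^T] has
   rank the number of columns. *)
pose A : 'M['F_2]_(NS, #|relsimp G k|) := \matrix_(i, l) (sx i == enum_val l)%:R.
have AAt : chains G k = A *m A^T.
  apply/matrixP => i j; rewrite !mxE.
  under eq_bigr do rewrite !mxE.
  rewrite -(big_enum_val (fun J => (sx i == J)%:R * (sx j == J)%:R)) /=.
  rewrite big_mkcond /= (bigD1 (sx i)) //= eqxx mul1r big1 ?addr0; last first.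
    by move=> J /negPf iJ; rewrite [sx i == J]eq_sym iJ mul0r if_same.
  rewrite [sx j == _]eq_sym (inj_eq enum_val_inj).
  by case: (sx i \in _); rewrite ?andbT ?andbF.
have AtA : A^T *m A = 1%:M.
  apply/matrixP => l l'; rewrite !mxE.
  under eq_bigr do rewrite !mxE.
  rewrite (bigD1 (enum_rank (enum_val l))) //= big1 ?addr0; last first.
    move=> i ne; rewrite (_ : sx i == enum_val l = false) ?mul0r //.
    apply/negbTE; apply: contra ne => /eqP <-; by rewrite /sx enum_valK.
  by rewrite /sx enum_rankK eqxx mul1r (inj_eq enum_val_inj).
apply/eqP; rewrite eqn_leq AAt mulmx_max_rank /=.
have e : A^T *m (A *m A^T) *m A = 1%:M by rewrite !mulmxA AtA mul1mx AtA.
rewrite -[X in (X <= _)%N](mxrank1 'F_2) -e.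
exact: leq_trans (mxrankM_maxl _ _) (mxrankM_maxr _ _).
Qed.

(** Rank-nullity counts the cycles, and the chain projector fixes the boundary matrix from the left.
    The subtractions are truncated. *)
Lemma betti_relE G k :
  betti_rel G k = (#|relsimp G k| - \rank (bdry G k) - \rank (bdry G k.+1))%N.
Proof.
have cb l : chains G l *m bdry G l = bdry G l.
  case: l => [|l]; first by rewrite /= mulmx0.
  apply/matrixP => i j; rewrite !mxE (bigD1 i) //= big1 ?addr0.
    by rewrite !mxE eqxx /=; case: (sx i \in _); rewrite ?mul1r ?mul0r.
  by move=> a /negPf ai; rewrite !mxE eq_sym ai mul0r.
rewrite /betti_rel /boundaries cb; congr (_ - _)%N.
rewrite -rank_chains -(mxrank_mul_ker (chains G k) (bdry G k)) cb.
by rewrite addnC addnK.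
Qed.

(** Reduces identities between subsets of ['I_3] to Boolean cases on the three vertices. *)
Lemma eq_set3 J K : (J == K) = [&& (vA \in J) == (vA \in K),
  (vB \in J) == (vB \in K) & (vR \in J) == (vR \in K)].
Proof.
apply/eqP/and3P => [->|[/eqP hA /eqP hB /eqP hR]]; first by rewrite !eqxx.
apply/setP => -[[|[|[|//]]] lt3].
- by rewrite (_ : Ordinal lt3 = vA) //; apply: val_inj.
- by rewrite (_ : Ordinal lt3 = vB) //; apply: val_inj.
- by rewrite (_ : Ordinal lt3 = vR) //; apply: val_inj.
Qed.

Lemma card_set3 J : #|J| = ((vA \in J) + (vB \in J) + (vR \in J))%N.
Proof.
rewrite -sum1_card big_mkcond /= !big_ord_recl big_ord0 addn0 addnA.
have -> : ord0 = vA by apply: val_inj.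
have -> : lift vA ord0 = vB by apply: val_inj.
have -> : lift vA (lift ord0 ord0) = vR by apply: val_inj.
by case: (vA \in J); case: (vB \in J); case: (vR \in J).
Qed.

(** A nonempty simplex lies outside [DeltaAB] exactly when it contains R, which leaves R, AR, BR and
    ABR. *)
Lemma mem_relsimp G k J :
  (J \in relsimp G k) = [&& J \in G, vR \in J & #|J| == k.+1].
Proof.
rewrite inE; congr (_ && _).
have [cJ|] := eqVneq #|J| k.+1; rewrite ?andbF ?andbT //.
have Jn0 : J != finset.set0 by rewrite -card_gt0 cJ.
rewrite inE Jn0 /=.
apply/negP/idP => [|RJ /fintype.subsetP /(_ _ RJ)]; last by rewrite !inE.
apply: contra_notT => RnJ; apply/fintype.subsetP => -[[|[|[|//]]] lt3].
- by rewrite (_ : Ordinal lt3 = vA) ?inE //; apply: val_inj.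
- by rewrite (_ : Ordinal lt3 = vB) ?inE //; apply: val_inj.
- by rewrite (_ : Ordinal lt3 = vR) ?(negPf RnJ) //; apply: val_inj.
Qed.

Variable G : {set {set 'I_3}}.
Hypothesis GR : [set vR] \in G.

Lemma relsimp0 : relsimp G 0 = [set [set vR]].
Proof.
apply/setP => J; rewrite mem_relsimp [RHS]inE.
apply/idP/idP => [/and3P[_]|/eqP ->]; last by rewrite GR cards1 inE eqxx.
rewrite card_set3 eq_set3 !inE.
by case: (vA \in J); case: (vB \in J); case: (vR \in J).
Qed.

Lemma relsimp1 : relsimp G 1 =
  [set J in [set [set vA; vR]; [set vB; vR]] | J \in G].
Proof.
apply/setP => J; rewrite mem_relsimp !inE andbC; congr (_ && _).
rewrite card_set3 !eq_set3 !inE /=.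
by case: (vA \in J); case: (vB \in J); case: (vR \in J).
Qed.

Lemma relsimp2 : relsimp G 2 = [set J in [set [set vA; vB; vR]] | J \in G].
Proof.
apply/setP => J; rewrite mem_relsimp !inE andbC; congr (_ && _).
rewrite card_set3 !eq_set3 !inE /=.
by case: (vA \in J); case: (vB \in J); case: (vR \in J).
Qed.

Lemma relsimp3 : relsimp G 3 = finset.set0.
Proof.
apply/setP => J; rewrite mem_relsimp !inE.
rewrite card_set3; case: (J \in G) => //.
by case: (vA \in J); case: (vB \in J); case: (vR \in J).
Qed.

(** Incidence is automatic because both relative edges contain R; likewise ABR contains both edges
    in [bdry2]. *)
Lemma bdry1 : bdry G 1 = outer (relsimp G 1) (relsimp G 0).
Proof.
apply/matrixP => i j; rewrite !mxE; congr (_%:R).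
rewrite andbA andb_idr // relsimp0 relsimp1 => /andP[+ /set1P ->].
by rewrite finset.sub1set !inE => /andP[/orP[] /eqP -> _]; rewrite !inE.
Qed.

Lemma bdry2 : bdry G 2 = outer (relsimp G 2) (relsimp G 1).
Proof.
apply/matrixP => i j; rewrite !mxE; congr (_%:R).
rewrite andbA andb_idr // relsimp1 relsimp2 !inE.
move=> /andP[/andP[/eqP -> _] /andP[/orP[] /eqP -> _]];
  apply/fintype.subsetP => x; rewrite !inE;
  by case: (x == vA); case: (x == vB); case: (x == vR).
Qed.

Lemma bdry3 : bdry G 3 = 0.
Proof. by apply/matrixP => i j; rewrite !mxE relsimp3 inE. Qed.

Let a := [set vA; vR] \in G.
Let b := [set vB; vR] \in G.
Let c := [set vA; vB; vR] \in G.

Lemma card_relsimp1 : #|relsimp G 1| = (a + b)%N.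
Proof.
rewrite relsimp1 -sum1_card big_mkcond /=.
rewrite (bigD1 [set vA; vR]) //= (bigD1 [set vB; vR]) /=; last first.
  by rewrite eq_set3 !inE.
rewrite big1 ?addn0; last first.
  by move=> J /andP[/negPf h1 /negPf h2]; rewrite !inE h1 h2.
by rewrite !inE !eqxx /= orbT /= /a /b; case: ([set vA; vR] \in G);
  case: ([set vB; vR] \in G).
Qed.

Lemma card_relsimp2 : #|relsimp G 2| = c.
Proof.
rewrite relsimp2 -sum1_card big_mkcond /=.
rewrite (bigD1 [set vA; vB; vR]) //=.
rewrite big1 ?addn0; last first.
  by move=> J /negPf h1; rewrite !inE h1.
by rewrite !inE !eqxx /= /c; case: ([set vA; vB; vR] \in G).
Qed.

Lemma rank_bdry1 : \rank (bdry G 1) = a || b.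
Proof.
rewrite bdry1 rank_outer -!card_gt0 card_relsimp1 relsimp0 cards1 andbT.
by case: a; case: b.
Qed.

Lemma rank_bdry2 : \rank (bdry G 2) = c && (a || b).
Proof.
rewrite bdry2 rank_outer -!card_gt0 card_relsimp1 card_relsimp2.
by case: a; case: b; case: c.
Qed.

(** The other endpoint of an edge at R lies in the subcomplex, so either edge makes R a relative
    boundary. *)
Lemma betti_rel0 : betti_rel G 0 = ~~ (a || b).
Proof.
rewrite betti_relE relsimp0 cards1 mxrank0 rank_bdry1.
by case: a; case: b.
Qed.

(** Both edges have relative boundary R, so their sum is a cycle over [Z_2]; ABR, when present,
    fills it. *)
Lemma betti_rel1 : betti_rel G 1 = [&& a, b & ~~ c].
Proof.
rewrite betti_relE card_relsimp1 rank_bdry1 rank_bdry2.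
by case: a; case: b; case: c.
Qed.

(** Detects ABR entering before both of its edges, which does not happen in a simplicial complex. *)
Lemma betti_rel2 : betti_rel G 2 = c && ~~ (a || b).
Proof.
rewrite betti_relE card_relsimp2 rank_bdry2 bdry3 mxrank0.
by case: a; case: b; case: c.
Qed.

End Homology.

(** * Integrals of interval indicators and the limit function *)

Section Integral.
Local Open Scope classical_set_scope.
Variable R : realType.
Implicit Types x y z lo hi : R.

Lemma Rintegral_step (f : R -> R) lo hi :
  (forall e : R, 0 <= e -> f e = (lo <= e < hi)%R%:R) ->
  Rintegral lebesgue_measure `[0, +oo[ f = Num.max 0 (hi - Num.max lo 0).
Proof.
move=> fE.
have ind (e : R) : \1_(`[lo, hi[%classic : set R) e = (lo <= e < hi)%R%:R :> R.
  by rewrite indicE mem_setE in_itv.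
transitivity (Rintegral lebesgue_measure `[0, +oo[
    (\1_(`[lo, hi[%classic : set R) : R -> R)).
  apply: eq_Rintegral => e; rewrite inE /= in_itv /= andbT => e0.
  by rewrite fE // -ind.
rewrite /Rintegral integral_indic //.
have -> : `[lo, hi[ `&` `[0, +oo[ = `[Num.max lo 0, hi[%classic :> set R.
  by apply/seteqP; split => e; rewrite /= !in_itv /= andbT ge_max;
    [move=> [/andP[-> ->] ->]|move=> /andP[/andP[-> ->] ->]].
have := @lebesgue_measure_itv R `[Num.max lo 0, hi[%R; rewrite /= lte_fin.
move=> ->.
case: ltP => h /=; first by rewrite [RHS]max_r // subr_ge0 ltW.
by rewrite [RHS]max_l // subr_le0.
Qed.

(* This form is also correct when [Gfilt] is not a simplicial complex (the
   subtraction in [betti_rel] truncates), so nothing is needed about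
   subadditivity of Tsallis entropies. *)
Definition euler_integral x y z : R :=
  Num.max 0 (Num.min x y - Num.max 0 0)
  - Num.max 0 (z - Num.max (Num.max x y) 0)
  + Num.max 0 (Num.min x y - Num.max z 0).

(** The three terms become [min x y], [z - max x y] and 0, and [min x y + max x y = x + y]. *)
Lemma euler_integral_mono x y z : 0 <= x -> 0 <= y -> x <= z -> y <= z ->
  euler_integral x y z = x + y - z.
Proof.
move=> x0 y0 xz yz; have z0 := le_trans x0 xz; rewrite /euler_integral.
rewrite maxxx subr0 (max_r (y := Num.min x y)) ?le_min ?x0 //.
rewrite (max_l (x := Num.max x y)) ?le_max ?x0 //.
rewrite (max_l (x := z)) // (max_r (y := z - _)) ?subr_ge0 ?ge_max ?xz //.
rewrite (max_l (y := _ - z)) ?subr_le0 ?ge_min ?xz //.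
by rewrite -(addr_max_min x y); ring.
Qed.

Lemma cvg_max (T : Type) (F : set_system T) (FF : Filter F) (f g : T -> R) x y :
  f @ F --> x -> g @ F --> y -> Num.max (f t) (g t) @[t --> F] --> Num.max x y.
Proof.
move=> fx gy; rewrite maxr_absE.
under eq_fun do rewrite maxr_absE.
apply: cvgM; last exact: cvg_cst.
by apply: cvgD; [exact: cvgD|apply: cvg_norm; exact: cvgB].
Qed.

Lemma cvg_min (T : Type) (F : set_system T) (FF : Filter F) (f g : T -> R) x y :
  f @ F --> x -> g @ F --> y -> Num.min (f t) (g t) @[t --> F] --> Num.min x y.
Proof.
move=> fx gy; rewrite minr_absE.
under eq_fun do rewrite minr_absE.
apply: cvgM; last exact: cvg_cst.
by apply: cvgB; [exact: cvgD|apply: cvg_norm; exact: cvgB].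
Qed.

Lemma euler_integral_cvg (T : Type) (F : set_system T) (FF : Filter F)
    (f g h : T -> R) x y z :
  f @ F --> x -> g @ F --> y -> h @ F --> z ->
  euler_integral (f t) (g t) (h t) @[t --> F] --> euler_integral x y z.
Proof.
move=> fx gy hz; rewrite /euler_integral.
by do ![exact: fx | exact: gy | exact: hz | exact: cvg_cst
       | apply: cvg_max | apply: cvg_min | apply: cvgB | apply: cvgD].
Qed.

End Integral.

(** * The integrated Euler characteristic in closed form *)

Section EulerIntegral.
Variable R : realType.

(** Each Betti number is the indicator in [eps] of an interval: from 0 to the smaller edge value,
    from the larger edge value to the ABR value, and from the ABR value to the smaller edge
    value. *)
Lemma Xq_euler_integral (dA dB dR : nat) (q : R)
    (rho : 'M[R[i]]_(dA * dB * dR)) :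
  Xq q rho = euler_integral (Cq q rho [set vA; vR]) (Cq q rho [set vB; vR])
    (Cq q rho [set vA; vB; vR]).
Proof.
have mem J : J != finset.set0 -> forall e,
    (J \in Gfilt q rho e) = (Cq q rho J <= e).
  by move=> J0 e; rewrite inE J0.
have n0 (J : {set 'I_3}) : vR \in J -> J != finset.set0.
  by move=> vJ; apply/set0Pn; exists vR.
(* [C_q] vanishes on singletons, so R is present for every nonnegative [eps]. *)
have GR e : 0 <= e -> [set vR] \in Gfilt q rho e.
  by move=> e0; rewrite mem ?n0 ?inE //= /Cq big_set1 subrr.
have sum3 (F : nat -> R) : \sum_(k < 3) F k = F 0%N + F 1%N + F 2%N.
  by rewrite !big_ord_recr big_ord0 /= add0r.
rewrite /Xq (sum3 (fun k => (-1) ^+ k * Rintegral lebesgue_measure `[0%R, +oo[%classic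
  (fun e : R => (betti_rel (Gfilt q rho e) k)%:R))).
rewrite expr0 mul1r expr1 mulN1r sqrrN expr1n mul1r /euler_integral.
congr (_ - _ + _); apply: Rintegral_step => e e0; congr (_%:R).
- rewrite betti_rel0 ?GR // !mem ?n0 ?inE // -?orbA //= e0.
  by rewrite lt_min negb_or -!ltNge.
- rewrite betti_rel1 ?GR // !mem ?n0 ?inE //=.
  by rewrite ge_max -ltNge andbA.
- rewrite betti_rel2 ?GR // !mem ?n0 ?inE //=.
  by rewrite negb_or -!ltNge lt_min.
Qed.

End EulerIntegral.

(** * Marginals of a tripartite state *)

Section Marginals.
Variable R : realType.
Local Notation C := (R[i]).

(** [f] splits a basis index into an environment part and a kept part. The form of [M] at [v] is the
    sum over [e] of the form of [rho] at the vector equal to [v] on block [e] and zero elsewhere. *)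
Lemma density_ptrace n m (E : finType) (rho : 'M[C]_n) (f : E * 'I_m -> 'I_n)
    (M : 'M[C]_m) :
  bijective f -> (forall i j, M i j = \sum_e rho (f (e, i)) (f (e, j))) ->
  density rho -> density M.
Proof.
move=> bf ME [psd_rho tr1].
have reind (F : 'I_n -> C) : \sum_x F x = \sum_e \sum_i F (f (e, i)).
  by rewrite (reindex f) ?sum_pair //; apply: onW_bij.
have [g gK _] := bf.
split; last first.
  rewrite -tr1 /mxtrace reind exchange_big; apply: eq_bigr => i _.
  by rewrite ME.
move=> v.
have -> : \sum_i \sum_j (v i)^* * M i j * v j =
    \sum_e \sum_i \sum_j (v i)^* * rho (f (e, i)) (f (e, j)) * v j.
  rewrite [RHS]exchange_big; apply: eq_bigr => i _.
  rewrite [RHS]exchange_big; apply: eq_bigr => j _.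
  by rewrite ME mulr_sumr mulr_suml.
apply: sumr_ge0 => e _.
have := psd_rho (fun x => (e == (g x).1)%:R * v (g x).2).
congr (_ <= _); rewrite reind.
transitivity (\sum_e1 (e == e1)%:R * \sum_i \sum_j
    (v i)^* * rho (f (e1, i)) (f (e, j)) * v j); last by rewrite sum_delta.
apply: eq_bigr => e1 _; rewrite mulr_sumr; apply: eq_bigr => i _.
rewrite reind mulr_sumr exchange_big; apply: eq_bigr => j _ /=.
under eq_bigr => e2 _ do rewrite !gK /= mulrCA.
by rewrite sum_delta rmorphM rmorph_nat -!mulrA.
Qed.

Variables dA dB dR : nat.
Variable rho : 'M[C]_(dA * dB * dR).
Hypothesis rhoD : density rho.

Definition split3 (x : 'I_(dA * dB * dR)) : 'I_dA * ('I_dB * 'I_dR) :=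
  let p := mxtens_unindex x in let q := mxtens_unindex p.1 in (q.1, (q.2, p.2)).

Lemma ixK a b r : split3 (ix a b r) = (a, (b, r)).
Proof. by rewrite /split3 /ix !mxtens_indexK. Qed.

Lemma split3K x : ix (split3 x).1 (split3 x).2.1 (split3 x).2.2 = x.
Proof.
case: (mxtens_indexP x) => p r; case: (mxtens_indexP p) => a b.
by rewrite -[mxtens_index _]/(ix a b r) ixK.
Qed.

Lemma mxtens_index_bij m n : bijective (@mxtens_index m n).
Proof. exists (@mxtens_unindex m n); [exact: mxtens_indexK|exact: mxtens_unindexK]. Qed.

Lemma rhoAB_density : density (rhoAB rho).
Proof.
pose f (x : 'I_dR * 'I_(dA * dB)) :=
  ix (mxtens_unindex x.2).1 (mxtens_unindex x.2).2 x.1.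
apply: (density_ptrace (f := f)) rhoD => [|i j]; last by rewrite mxE.
exists (fun x => ((split3 x).2.2, mxtens_index ((split3 x).1, (split3 x).2.1))).
  by case=> e i; case: (mxtens_indexP i) => k l; rewrite /f mxtens_indexK ixK.
by move=> x; rewrite /f mxtens_indexK split3K.
Qed.

Lemma rhoAR_density : density (rhoAR rho).
Proof.
pose f (x : 'I_dB * 'I_(dA * dR)) :=
  ix (mxtens_unindex x.2).1 x.1 (mxtens_unindex x.2).2.
apply: (density_ptrace (f := f)) rhoD => [|i j]; last by rewrite mxE.
exists (fun x => ((split3 x).2.1, mxtens_index ((split3 x).1, (split3 x).2.2))).
  by case=> e i; case: (mxtens_indexP i) => k l; rewrite /f mxtens_indexK ixK.
by move=> x; rewrite /f mxtens_indexK split3K.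
Qed.

Lemma rhoBR_density : density (rhoBR rho).
Proof.
pose f (x : 'I_dA * 'I_(dB * dR)) :=
  ix x.1 (mxtens_unindex x.2).1 (mxtens_unindex x.2).2.
apply: (density_ptrace (f := f)) rhoD => [|i j]; last by rewrite mxE.
exists (fun x => ((split3 x).1, mxtens_index ((split3 x).2.1, (split3 x).2.2))).
  by case=> e i; case: (mxtens_indexP i) => k l; rewrite /f mxtens_indexK ixK.
by move=> x; rewrite /f mxtens_indexK split3K.
Qed.

Lemma rhoA_density : density (rhoA rho).
Proof.
pose f (x : 'I_dB * 'I_dR * 'I_dA) := ix x.2 x.1.1 x.1.2.
apply: (density_ptrace (f := f)) rhoD => [|i j]; last by rewrite mxE sum_pair.
exists (fun x => ((split3 x).2.1, (split3 x).2.2, (split3 x).1)).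
  by case=> [[b r] a]; rewrite /f ixK.
by move=> x; rewrite /f /= split3K.
Qed.

Lemma rhoB_density : density (rhoB rho).
Proof.
pose f (x : 'I_dA * 'I_dR * 'I_dB) := ix x.1.1 x.2 x.1.2.
apply: (density_ptrace (f := f)) rhoD => [|i j]; last by rewrite mxE sum_pair.
exists (fun x => ((split3 x).1, (split3 x).2.2, (split3 x).2.1)).
  by case=> [[b r] a]; rewrite /f ixK.
by move=> x; rewrite /f /= split3K.
Qed.

Lemma rhoR_density : density (rhoR rho).
Proof.
pose f (x : 'I_dA * 'I_dB * 'I_dR) := ix x.1.1 x.1.2 x.2.
apply: (density_ptrace (f := f)) rhoD => [|i j]; last by rewrite mxE sum_pair.
exists (fun x => ((split3 x).1, (split3 x).2.1, (split3 x).2.2)).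
  by case=> [[b r] a]; rewrite /f ixK.
by move=> x; rewrite /f /= split3K.
Qed.

Lemma Sq_cvg J : (Sq q rho J @[q --> 1^'+] --> S rho J)%classic.
Proof.
rewrite /S /Sq /marg.
case: (vA \in J); case: (vB \in J); case: (vR \in J); last exact: cvg_cst.
- exact: tsallis_cvg.
- exact: tsallis_cvg rhoAB_density.
- exact: tsallis_cvg rhoAR_density.
- exact: tsallis_cvg rhoA_density.
- exact: tsallis_cvg rhoBR_density.
- exact: tsallis_cvg rhoB_density.
- exact: tsallis_cvg rhoR_density.
Qed.

Lemma Cq_cvg J :
  (Cq q rho J @[q --> 1^'+] --> \sum_(v in J) S rho [set v]%SET - S rho J)%classic.
Proof.
rewrite /Cq; apply: cvgB; last exact: Sq_cvg.
apply: cvg_big => [|v _]; [exact: add_continuous|exact: Sq_cvg].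
Qed.

(** The first factor is the one removed by [ptrace], so [FABR] reduces to BR and its reordering
    [FBAR] to AR. *)
Let FABR (x y : 'I_dA * ('I_dB * 'I_dR)) : C :=
  rho (ix x.1 x.2.1 x.2.2) (ix y.1 y.2.1 y.2.2).
Let FBAR (x y : 'I_dB * ('I_dA * 'I_dR)) : C :=
  rho (ix x.2.1 x.1 x.2.2) (ix y.2.1 y.1 y.2.2).

Lemma density_entropy n (M : 'M[C]_n) : density M ->
  has_entropy (fun i j => M i j) (vonNeumann M).
Proof. by case=> psdM _; exact: psd_has_entropy. Qed.

Lemma entropy_ABR : has_entropy FABR (vonNeumann rho).
Proof.
apply: (has_entropy_reindex (f := fun x => ix x.1 x.2.1 x.2.2)).
  by exists split3 => x; [rewrite ixK; case: x => a []|rewrite split3K].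
exact: density_entropy.
Qed.

Lemma entropy_BAR : has_entropy FBAR (vonNeumann rho).
Proof.
apply: (has_entropy_reindex (f := fun x => ix x.2.1 x.1 x.2.2)).
  exists (fun x => ((split3 x).2.1, ((split3 x).1, (split3 x).2.2))) => x.
    by rewrite ixK; case: x => a [].
  by rewrite /= split3K.
exact: density_entropy.
Qed.

Lemma entropy_AR :
  has_entropy (fun x y => rhoAR rho (mxtens_index x) (mxtens_index y))
    (vonNeumann (rhoAR rho)).
Proof.
apply: (has_entropy_reindex (mxtens_index_bij dA dR)).
exact: density_entropy rhoAR_density.
Qed.

Lemma entropy_BR :
  has_entropy (fun x y => rhoBR rho (mxtens_index x) (mxtens_index y))
    (vonNeumann (rhoBR rho)).
Proof.
apply: (has_entropy_reindex (mxtens_index_bij dB dR)).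
exact: density_entropy rhoBR_density.
Qed.

Lemma rhoARE x y : rhoAR rho (mxtens_index x) (mxtens_index y) =
  \sum_b rho (ix x.1 b x.2) (ix y.1 b y.2).
Proof. by rewrite mxE !mxtens_indexK. Qed.

Lemma rhoBRE x y : rhoBR rho (mxtens_index x) (mxtens_index y) =
  \sum_a rho (ix a x.1 x.2) (ix a y.1 y.2).
Proof. by rewrite mxE !mxtens_indexK. Qed.

Lemma ktr_mxtens m n (M : 'M[C]_(m * n)) :
  ktr (fun x y => M (mxtens_index x) (mxtens_index y)) = \tr M.
Proof.
by rewrite /mxtrace (reindex (@mxtens_index m n)) //;
  apply: onW_bij; exact: mxtens_index_bij.
Qed.

Lemma vonNeumann_strong_subadditivity :
  vonNeumann rho + vonNeumann (rhoR rho) <=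
  vonNeumann (rhoAR rho) + vonNeumann (rhoBR rho).
Proof.
apply: (strong_subadditivity entropy_ABR).
- have -> : ptrace FABR = fun x y => rhoBR rho (mxtens_index x) (mxtens_index y).
    by apply/funext => x; apply/funext => y; rewrite rhoBRE.
  exact: entropy_BR.
- have -> : mid_ptrace FABR = fun x y => rhoAR rho (mxtens_index x) (mxtens_index y).
    by apply/funext => x; apply/funext => y; rewrite rhoARE.
  exact: entropy_AR.
- have -> : ptrace (ptrace FABR) = fun r r' => rhoR rho r r'.
    apply/funext => x; apply/funext => y; rewrite mxE.
    by rewrite [RHS]exchange_big.
  exact: density_entropy rhoR_density.
Qed.

Lemma vonNeumann_subadditivity_AR :
  vonNeumann (rhoAR rho) <= vonNeumann (rhoA rho) + vonNeumann (rhoR rho).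
Proof.
apply: subadditivity entropy_AR _ _.
- by rewrite ktr_mxtens; case: rhoAR_density.
- rewrite [X in has_entropy X](_ : _ = fun a a' => rhoA rho a a').
    exact: density_entropy rhoA_density.
  apply/funext => a; apply/funext => a'; rewrite mxE exchange_big.
  by apply: eq_bigr => r _; rewrite rhoARE.
- rewrite [X in has_entropy X](_ : _ = fun a a' => rhoR rho a a').
    exact: density_entropy rhoR_density.
  apply/funext => a; apply/funext => a'; rewrite mxE.
  by apply: eq_bigr => r _; rewrite rhoARE.
Qed.

Lemma vonNeumann_subadditivity_BR :
  vonNeumann (rhoBR rho) <= vonNeumann (rhoB rho) + vonNeumann (rhoR rho).
Proof.
apply: subadditivity entropy_BR _ _.
- by rewrite ktr_mxtens; case: rhoBR_density.
- rewrite [X in has_entropy X](_ : _ = fun a a' => rhoB rho a a').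
    exact: density_entropy rhoB_density.
  apply/funext => a; apply/funext => a'; rewrite mxE exchange_big.
  by apply: eq_bigr => r _; rewrite rhoBRE.
- rewrite [X in has_entropy X](_ : _ = fun a a' => rhoR rho a a').
    exact: density_entropy rhoR_density.
  apply/funext => a; apply/funext => a'; rewrite mxE exchange_big.
  by apply: eq_bigr => r _; rewrite rhoBRE.
Qed.

Lemma vonNeumann_subadditivity_A_BR :
  vonNeumann rho <= vonNeumann (rhoA rho) + vonNeumann (rhoBR rho).
Proof.
apply: subadditivity entropy_ABR _ _.
- have [_ <-] := rhoA_density.
  by rewrite /ktr sum_pair; apply: eq_bigr => a _; rewrite mxE sum_pair.
- rewrite [X in has_entropy X](_ : _ = fun a a' => rhoA rho a a').
    exact: density_entropy rhoA_density.
  by apply/funext => a; apply/funext => a'; rewrite mxE sum_pair.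
- rewrite [X in has_entropy X](_ : _ =
     fun x y => rhoBR rho (mxtens_index x) (mxtens_index y)).
    exact: entropy_BR.
  by apply/funext => x; apply/funext => y; rewrite rhoBRE.
Qed.

Lemma vonNeumann_subadditivity_B_AR :
  vonNeumann rho <= vonNeumann (rhoB rho) + vonNeumann (rhoAR rho).
Proof.
apply: subadditivity entropy_BAR _ _.
- have [_ <-] := rhoB_density.
  by rewrite /ktr sum_pair; apply: eq_bigr => a _; rewrite mxE sum_pair.
- rewrite [X in has_entropy X](_ : _ = fun a a' => rhoB rho a a').
    exact: density_entropy rhoB_density.
  by apply/funext => a; apply/funext => a'; rewrite mxE sum_pair.
- rewrite [X in has_entropy X](_ : _ =
     fun x y => rhoAR rho (mxtens_index x) (mxtens_index y)).
    exact: entropy_AR.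
  by apply/funext => x; apply/funext => y; rewrite rhoARE.
Qed.

Lemma CMI_ge0 : 0 <= CMI rho.
Proof.
rewrite /CMI /S /marg !inE /=.
have := vonNeumann_strong_subadditivity; lra.
Qed.

Lemma Xq_cvg : (Xq q rho @[q --> 1^'+] --> - CMI rho)%classic.
Proof.
under eq_fun do rewrite Xq_euler_integral.
pose T (J : {set 'I_3}) := \sum_(v in J) S rho [set v]%SET - S rho J.
have TE : euler_integral (T [set vA; vR]%SET) (T [set vB; vR]%SET)
    (T [set vA; vB; vR]%SET) = - CMI rho.
  have sum3 (J : {set 'I_3}) (h : 'I_3 -> R) : \sum_(v in J) h v =
      (if vA \in J then h vA else 0) + (if vB \in J then h vB else 0)
      + (if vR \in J then h vR else 0).
    rewrite big_mkcond /= !big_ord_recl big_ord0 addr0 addrA.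
    have -> : ord0 = vA by apply: val_inj.
    have -> : lift vA ord0 = vB by apply: val_inj.
    by have -> : lift vA (lift ord0 ord0) = vR by apply: val_inj.
  (* These four inequalities say that the total correlations of AR and BR are nonnegative and at
     most that of ABR. *)
  have sAR := vonNeumann_subadditivity_AR.
  have sBR := vonNeumann_subadditivity_BR.
  have sA := vonNeumann_subadditivity_A_BR.
  have sB := vonNeumann_subadditivity_B_AR.
  rewrite /T !sum3 /CMI /S /marg !inE /=.
  by rewrite euler_integral_mono; lra.
rewrite -TE; apply: euler_integral_cvg; exact: Cq_cvg.
Qed.

End Marginals.

(** * The limit as [q] decreases to 1, and its sign *)

Local Open Scope classical_set_scope.

Theorem theorem4 (R : realType) (dA dB dR : nat)
    (rho : 'M[R[i]]_(dA * dB * dR)) :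
  density rho ->
  Xq q rho @[q --> 1%R^'+] --> - CMI rho /\ - CMI rho <= 0.
Proof.
move=> rhoD; split; first exact: Xq_cvg.
by rewrite oppr_le0; exact: CMI_ge0.
Qed.
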